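(* Let $G$ be a graph with vertex set $[n]$ whose maximum degree $\Delta$ satisfies $\Delta\gg\ln^4 n$, let $p\gg\frac{\ln^4 n}{\Delta}$ (with $p\le 1$), and let $G_p$ be the bond percolation of $G$ with probability $p$. Then almost surely $$|\lambda_i(A(G_p))-p\,\lambda_i(A(G))|\le(2+o(1))\sqrt{p\Delta}\qquad\text{for each } 1\le i\le n.$$
   Context: The bond percolation of a (deterministic) host graph $G$ on $[n]=\{1,\dots,n\}$ with probability $p$ is the random spanning subgraph $G_p$ of $G$ in which each edge $\{i,j\}$ of $G$ is retained with probability $p$, independently of the other edges. $A(H)$ denotes the adjacency matrix of a graph $H$. For an $n\times n$ symmetric matrix $M$, $\lambda_1(M)\le\dots\le\lambda_n(M)$ are its eigenvalues in non-decreasing order, with multiplicity. The graph $G=G^{(n)}$, $p=p(n)$ and $\Delta=\Delta(n)$ depend on $n$ and asymptotics are as $n\to\infty$: $f\gg h$ means $f(n)/h(n)\to\infty$, $o(1)$ is a deterministic quantity tending to $0$ (uniform in $i$), and ''almost surely'' means with probability tending to $1$ as $n\to\infty$. *)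

(* Defs.v *)
From HB Require Import structures.
From mathcomp Require Import all_boot all_order all_algebra.
From mathcomp Require Import polyrcf.
From mathcomp Require complex.
From mathcomp Require Import all_classical all_reals all_analysis.

Set Implicit Arguments.
Unset Strict Implicit.
Unset Printing Implicit Defensive.

Import Order.TTheory GRing.Theory Num.Theory.
Import numFieldNormedType.Exports.
Local Open Scope classical_set_scope.
Local Open Scope ring_scope.

(* A graph on the vertex set 'I_n is given by its edge set, an edge being the
   two-element set of its endpoints; the vertices are numbered from 0. *)
Definition simple_graph (n : nat) (E : {set {set 'I_n}}) : Prop :=
  forall e, e \in E -> #|e| = 2.

Definition degree (n : nat) (E : {set {set 'I_n}}) (i : 'I_n) : nat :=
  #|[set j | [set i; j]%SET \in E]%SET|.

Definition max_degree (n : nat) (E : {set {set 'I_n}}) : nat :=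
  (\max_(i < n) degree E i)%N.

(* When E is a simple graph the diagonal vanishes, since [set i; i] = [set i]
   is not an edge. *)
Definition adjmx (R : realType) (n : nat) (E : {set {set 'I_n}}) : 'M[R]_n :=
  \matrix_(i, j) ([set i; j]%SET \in E)%:R.

(* The real roots of the characteristic polynomial in increasing order, each
   repeated according to its multiplicity. *)
Definition eigenvalues (R : realType) (n : nat) (A : 'M[R]_n) : seq R :=
  flatten [seq nseq (mup x (char_poly A)) x | x <- rootsR (char_poly A)].

(* 0-based: eigval A i is lambda_(i+1)(A).  The default 0 is never reached for
   a symmetric A, by size_eigenvalues below. *)
Definition eigval (R : realType) (n : nat) (A : 'M[R]_n) (i : 'I_n) : R :=
  nth 0 (eigenvalues A) i.

(* The law of the bond percolation E_p: the sample space is the set of all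
   edge subsets H of E (the spanning subgraphs), under the product of
   Bernoulli(p) laws indexed by the edges of E. *)
Definition percolation_weight (R : realType) (n : nat) (E : {set {set 'I_n}})
    (p : R) (H : {set {set 'I_n}}) : R :=
  \prod_(e in E) (if e \in H then p else 1 - p).

Definition percolation_prob (R : realType) (n : nat) (E : {set {set 'I_n}})
    (p : R) (Q : pred {set {set 'I_n}}) : R :=
  \sum_(H in powerset E | Q H) percolation_weight E p H.

Definition much_greater (R : realType) (f h : nat -> R) : Prop :=
  (fun n => f n / h n) @ \oo --> +oo.

Section Eigenvalues.
Variables (R : realType) (n : nat) (A : 'M[R]_n).

Lemma char_poly_neq0 : char_poly A != 0.
Proof. by rewrite monic_neq0 ?char_poly_monic. Qed.

Lemma count_eigenvalues (x : R) :
  count_mem x (eigenvalues A) = mup x (char_poly A).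
Proof.
rewrite /eigenvalues count_flatten -map_comp.
have -> : sumn [seq (count_mem x \o (fun y => nseq (mup y (char_poly A)) y)) y
      | y <- rootsR (char_poly A)]
    = (\sum_(y <- rootsR (char_poly A)) (y == x) * mup y (char_poly A))%N.
  by rewrite sumnE big_map; apply: eq_bigr => y _ /=; rewrite count_nseq.
have [xr|xr] := boolP (x \in rootsR (char_poly A)).
  rewrite (bigD1_seq x) //= ?uniq_roots // eqxx mul1n big1 ?addn0 //.
  by move=> y /negPf ->.
rewrite big1_seq; last first.
  move=> y /= yr; have [yx|//] := eqVneq y x.
  by rewrite -yx yr in xr.
rewrite mupNroot //; move: xr; apply: contra => rx.
by rewrite -(roots_on_rootsR char_poly_neq0 x) inE.
Qed.

Lemma sorted_eigenvalues : sorted <=%R (eigenvalues A).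
Proof.
rewrite sorted_pairwise; last exact: le_trans.
rewrite /eigenvalues.
have : pairwise <%R (rootsR (char_poly A)).
  by rewrite -sorted_pairwise ?sorted_roots //; exact: lt_trans.
elim: (rootsR _) => //= y s IH /andP[ys ss].
rewrite pairwise_cat IH // andbT; apply/andP; split.
  apply/allrelP => u v /nseqP[-> _] /flatten_mapP[w ws /nseqP[-> _]].
  by rewrite ltW // (allP ys).
by elim: (mup _ _) => //= m ->; rewrite andbT; apply/allP => z /nseqP[-> _].
Qed.

Lemma char_poly_conj (F : fieldType) (P D : 'M[F]_n) :
  P \in unitmx -> char_poly (invmx P *m D *m P) = char_poly D.
Proof.
move=> uP; rewrite /char_poly /char_poly_mx.
pose Q : 'M[{poly F}]_n := map_mx polyC P.
have Q1 : map_mx polyC (invmx P) *m Q = 1%:M.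
  by rewrite -map_mxM mulVmx // map_mx1.
have -> : 'X%:M - map_mx polyC (invmx P *m D *m P)
    = map_mx polyC (invmx P) *m ('X%:M - map_mx polyC D) *m Q.
  rewrite mulmxBr mulmxBl !map_mxM -/Q; congr (_ - _).
  by rewrite -mulmxA mul_scalar_mx -scalemxAr Q1 scalemx1.
by rewrite !det_mulmx mulrAC -det_mulmx Q1 det1 mul1r.
Qed.

Import complex.
Local Notation C := (complex R).
Local Notation toC := (real_complex R).

Lemma char_poly_real_split : A^T = A ->
  exists s : seq R, char_poly A = \prod_(x <- s) ('X - x%:P).
Proof.
move=> symA.
pose B : 'M[C]_n := map_mx toC A.
have Bh : B \is hermsymmx.
  apply: realsym_hermsym.
    apply/is_hermitianmxP; rewrite expr0 scale1r map_mx_id //.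
    by apply/matrixP => i j; rewrite !mxE -{1}symA mxE.
  by apply/mxOverP => i j; rewrite mxE complex_real.
have Bn : B \is normalmx by exact: hermitian_normalmx.
have /orthomx_spectralP BE := Bn.
have dr := hermitian_spectral_diag_real Bh.
exists [seq complex.Re (spectral_diag B 0 i) | i <- enum 'I_n].
apply: (map_poly_inj (real_complex R)).
rewrite map_char_poly -/B {1}BE char_poly_conj ?spectral_unit //.
rewrite char_poly_trig ?diag_mx_is_trig // rmorph_prod /= big_map big_enum /=.
apply: eq_bigr => i _; rewrite rmorphB /= map_polyX map_polyC /= mxE eqxx mulr1n.
by rewrite RRe_real // (mxOverP dr).
Qed.

Lemma char_poly_eigenvalues : A^T = A ->
  char_poly A = \prod_(x <- eigenvalues A) ('X - x%:P).
Proof.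
move=> /char_poly_real_split[s Es]; rewrite {1}Es; apply: perm_big.
apply/allP => x _ /=; rewrite count_eigenvalues Es mu_prod_XsubC.
exact: eqxx.
Qed.

Lemma size_eigenvalues : A^T = A -> size (eigenvalues A) = n.
Proof.
move=> /char_poly_eigenvalues E; have := size_char_poly A.
by rewrite E size_prod_XsubC => -[].
Qed.

End Eigenvalues.

Section Percolation.
Variables (R : realType) (n : nat) (E : {set {set 'I_n}}) (p : R).

Lemma adjmx_sym : (adjmx R E)^T = adjmx R E.
Proof. by apply/matrixP => i j; rewrite !mxE finset.setUC. Qed.

(* Mutual independence of the retention events, each of probability p; with
   F = finset.set0 this says that the total mass is 1. *)
Lemma percolation_prob_subset (F : {set {set 'I_n}}) : F \subset E ->
  percolation_prob E p (fun H => F \subset H) = p ^+ #|F|.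
Proof.
move=> FE; pose a e := if e \in E then p else 0.
pose b e : R := if e \in E then (if e \in F then 0 else 1 - p) else 1.
have -> : p ^+ #|F| = \prod_e (a e + b e).
  rewrite -prodr_const big_mkcond /=; apply: eq_bigr => e _.
  rewrite /a /b; case: ifPn => eF; first by rewrite (fintype.subsetP FE) // addr0.
  by case: ifP => _; rewrite ?add0r // addrC subrK.
rewrite bigA_distr /percolation_prob big_mkcond [RHS]big_mkcond /=.
apply: eq_bigr => H _; rewrite powersetE.
have [HE|/subsetPn[e eH eE]] /= := boolP (H \subset E); last first.
  by rewrite (bigD1 e) //= eH /a (negPf eE) mul0r.
have [FH|/subsetPn[e eF eH]] := boolP (F \subset H); last first.
  by rewrite (bigD1 e) //= (negPf eH) /b (fintype.subsetP FE) // eF mul0r.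
rewrite /percolation_weight big_mkcond /=; apply: eq_bigr => e _.
rewrite /a /b; case: ifPn => eE.
  by case: ifPn => // eH; rewrite ifN //; apply: contra eH; apply: (fintype.subsetP FH).
by rewrite ifN //; apply: contra eE; apply: (fintype.subsetP HE).
Qed.

End Percolation.

(* Main.v *)
Require Import Defs.
From mathcomp Require Import all_boot all_order all_algebra.
From mathcomp Require complex.
From mathcomp Require Import all_classical all_reals all_analysis.
From mathcomp Require Import zify ring lra.

(** Write d = p Delta and M = A(G_p) - p A(G), a random symmetric matrix
    whose entries are bounded by 1, centred, and independent up to the symmetry.
    If N is even and
    tr M^N <= b^N, then every eigenvalue of M is at most b in absolute value,
    and Weyl's inequality (weyl_trace) moves lambda_i(A(G_p)) away from
    p lambda_i(A(G)) by at most b.  By Markov's inequality it is therefore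
    enough to bound E tr M^N by about n (2 sqrt d)^N for some N that is large
    compared with ln n: the prefactor n then costs only a factor 1 + o(1) in b.

    The expectation of tr M^N is a sum over closed walks of length N in G.
    A walk contributes 0 if it uses some edge exactly once, and otherwise at
    most p to the number of its distinct edges.  The walks are explored step by
    step (mean_walk_le).  The total weight p^(distinct edges) is spread over the
    steps (step_ratio): a first use of an edge has weight sqrt d / Delta, a
    second use sqrt d, a later use 1.  Then

    - the steps to a fresh vertex have total weight at most sqrt d, there being
      at most Delta of them;
    - if the current vertex has only one open edge, that is, one used exactly
      once so far, closing it has weight sqrt d;
    - the later uses, at most N choices, weigh at most N, and first uses of an
      edge that leads to an already visited vertex, at most 2 N choices, weigh
      at most 2 N sqrt d / Delta: both are negligible against sqrt d.

    So every step contributes a factor (2 + o(1)) sqrt d, were it not for the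
    closing steps at a vertex with several open edges, where there may be up to
    N choices instead of one.  These are paid for by a potential N^excess.
    The excess counts, over all vertices x, the open edges at x beyond the
    number expected when the open edges form a path that ends at the current
    vertex: 1 at the current vertex and 2 elsewhere.  An ambiguous closing step
    lowers the excess, which compensates the number of choices.  Only the
    negligible steps can raise it, a later use by at most 1 and a new edge to a
    visited vertex by at most 2, so that with the potential their weights
    become N^2 and 2 N^3 sqrt d / Delta.  Relatively to sqrt d this is at most
    x + x^2 with x = N^2 / sqrt d (step_sum_le), and x tends to 0 precisely if
    d dominates N^4.  Since d dominates ln^4 n, there is room for an N that
    dominates ln n. *)

Set Implicit Arguments.
Unset Strict Implicit.
Unset Printing Implicit Defensive.

Import Order.TTheory GRing.Theory Num.Theory.
Import numFieldNormedType.Exports.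
Local Open Scope ring_scope.

(** * Open edges and the excess of a walk *)

Section Histories.
Variable V : finType.
Implicit Types (u v x : V) (e : {set V}) (es : seq {set V}).

Definition open_degree es x : nat :=
  (\sum_(e : {set V}) ((x \in e) && (count_mem e es == 1)))%N.

(** The truncated difference is taken with 1 at the current vertex u and with 2
    at every other vertex: a path of open edges from the root to u has excess 0. *)
Definition excess u es : nat :=
  (\sum_(x : V) (open_degree es x - (x != u).+1))%N.

Lemma open_degree_cons e es x :
  open_degree (e :: es) x =
  (if x \in e then open_degree es x + (count_mem e es == 0) - (count_mem e es == 1)
   else open_degree es x)%N.
Proof.
rewrite /open_degree (bigD1 e) //= [in RHS](bigD1 e) //=.
rewrite (eq_bigr (fun f : {set V} => nat_of_bool ((x \in f) && (count_mem f es == 1%N)))); last first.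
  by move=> f fe; rewrite /= (eq_sym e) (negPf fe).
rewrite eqxx; case: (x \in e) => /=; last by [].
case: (count_mem e es) => [|[|c]] /=; lia.
Qed.

(** A step from u to v changes the open edges only at u and at v, while the
    allowance of u grows from 1 to 2 and that of v shrinks from 2 to 1.  The four
    lemmas on the types of steps are read off from these two formulas. *)
Lemma excess_step u v es : u != v ->
  let c := count_mem [set u; v]%SET es in
  let rest := (\sum_(x | (x != u) && (x != v)) (open_degree es x - 2))%N in
  excess u es = (rest + (open_degree es u - 1) + (open_degree es v - 2))%N /\
  excess v ([set u; v]%SET :: es) =
   (rest + (open_degree es u + (c == 0) - (c == 1) - 2)
         + (open_degree es v + (c == 0) - (c == 1) - 1))%N.
Proof.
move=> uv c rest; split.
  rewrite /excess (bigD1 u) //= eqxx (bigD1 v) 1?eq_sym //= uv.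
  rewrite (eq_bigr (fun x => open_degree es x - 2)%N); last first.
    by move=> x /andP[-> _].
  rewrite /rest; lia.
rewrite /excess (bigD1 u) //= uv (bigD1 v) 1?eq_sym //= eqxx.
rewrite (eq_bigr (fun x => open_degree es x - 2)%N); last first.
  move=> x /andP[xu xv]; rewrite xv open_degree_cons !inE.
  by rewrite (negPf xu) (negPf xv).
rewrite !open_degree_cons !inE !eqxx orbT /= -/c /rest; lia.
Qed.

Lemma open_degree_gt0 u v es : count_mem [set u; v]%SET es = 1%N ->
  (0 < open_degree es u)%N /\ (0 < open_degree es v)%N.
Proof.
by move=> c1; split; rewrite /open_degree (bigD1 [set u; v]%SET) //= !inE eqxx ?orbT c1.
Qed.

Lemma open_degree_eq0 v es : ~~ has (fun e => v \in e) es -> open_degree es v = 0%N.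
Proof.
move=> /hasPn h; rewrite /open_degree big1 // => e _.
case ve: (v \in e) => //=; case: eqP => // c1.
have : e \in es by rewrite -has_pred1 has_count c1.
by move/h; rewrite ve.
Qed.

Lemma excess_fresh u v es : u != v -> ~~ has (fun e => v \in e) es ->
  (excess v ([set u; v]%SET :: es) <= excess u es)%N.
Proof.
move=> uv /open_degree_eq0 v0; have [-> ->] := excess_step es uv.
rewrite v0; case: (count_mem _ _) => [|[|c]] /=; lia.
Qed.

Lemma excess_new_edge u v es : u != v -> count_mem [set u; v]%SET es = 0%N ->
  (excess v ([set u; v]%SET :: es) <= excess u es + 2)%N.
Proof. by move=> uv c0; have [-> ->] := excess_step es uv; rewrite c0 /=; lia. Qed.

(** This is where an ambiguous closing step pays for its choices: u loses an
    open edge and gains allowance, whereas at v the two changes cancel. *)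
Lemma excess_close u v es : u != v -> count_mem [set u; v]%SET es = 1%N ->
  (excess v ([set u; v]%SET :: es) + (1 < open_degree es u) <= excess u es)%N.
Proof.
move=> uv c1; have [su sv] := open_degree_gt0 c1.
have [-> ->] := excess_step es uv; rewrite c1 /=.
case: ltnP => /=; lia.
Qed.

Lemma excess_repeat u v es : u != v -> (1 < count_mem [set u; v]%SET es)%N ->
  (excess v ([set u; v]%SET :: es) <= excess u es + 1)%N.
Proof.
move=> uv c2; have [-> ->] := excess_step es uv.
by case: (count_mem _ _) c2 => [|[|c]] //= _; lia.
Qed.

Lemma set2_injr u : injective (fun v => [set u; v]%SET).
Proof.
move=> v w E; have := set22 u v; rewrite E => /set2P[vu|//].
by have := set22 u w; rewrite -E => /set2P[->|->].
Qed.

Lemma card_open_le u es :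
  (#|[set v | count_mem [set u; v]%SET es == 1%N]%SET| <= open_degree es u)%N.
Proof.
rewrite -(card_imset _ (@set2_injr u)) /open_degree -sum1_card big_mkcond.
apply: leq_sum => e _; case: ifP => // /imsetP[v].
by rewrite inE => cv ->; rewrite cv !inE eqxx.
Qed.

Lemma card_traversed_le u es :
  (#|[set v | [set u; v]%SET \in es]%SET| <= size es)%N.
Proof.
rewrite -(card_imset _ (@set2_injr u)); apply: leq_trans (card_size es).
by apply/subset_leq_card/fintype.subsetP => e /imsetP[v]; rewrite inE => ? ->.
Qed.

Lemma open_degree_le u es : (open_degree es u <= size es)%N.
Proof.
apply: leq_trans (card_size es); rewrite /open_degree -sum1_card [leqRHS]big_mkcond.
apply: leq_sum => e _; case: andP => // -[_ /eqP c1].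
by rewrite -has_pred1 has_count c1.
Qed.

Lemma card_visited_le es : all (fun e => #|e| == 2%N) es ->
  (#|[set v | has (fun e => v \in e) es]%SET| <= 2 * size es)%N.
Proof.
elim: es => [|e es IH] /= => [_|/andP[/eqP e2 /IH le]].
  by rewrite leqn0 cards_eq0; apply/eqP/setP => x; rewrite !inE.
rewrite mulnS -{1}e2; apply: leq_trans (leq_add (leqnn _) le).
apply: leq_trans (subset_leq_card _) (leq_card_setU _ _).
by apply/fintype.subsetP => v; rewrite !inE.
Qed.
End Histories.

(** * Weights of the steps *)

Lemma sum_indicator_le (R : numDomainType) (I : finType) (P Q : pred I) (a : R)
    (m : nat) : 0 <= a -> (#|[set i | Q i]%SET| <= m)%N ->
  \sum_(i | P i) (Q i)%:R * a <= m%:R * a.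
Proof.
move=> a0 le; rewrite -mulr_suml ler_wpM2r // -natr_sum ler_nat.
apply: leq_trans le; rewrite -sum1_card [leqRHS]big_mkcond [leqLHS]big_mkcond.
by apply: leq_sum => i _; rewrite inE; case: (P i); case: (Q i).
Qed.

Section Weights.
Variables (R : realType) (V : finType) (E : {set {set V}}) (D N : nat) (p s : R).
Hypothesis E2 : forall e, e \in E -> #|e| = 2%N.
Hypothesis degD : forall u, (#|[set v | [set u; v]%SET \in E]%SET| <= D)%N.
Hypothesis D0 : (0 < D)%N.
Hypothesis N2 : (1 < N)%N.
Hypothesis p1 : p <= 1.
Hypothesis s0 : 0 < s.
Hypothesis sE : s ^+ 2 = p * D%:R.
Implicit Types (u v : V) (e : {set V}) (es : seq {set V}).

(** mult_weight c bounds the absolute value of the c-th central moment of a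
    Bernoulli(p) variable, when s = sqrt (p D).  The true first moment is 0: the positive value used for
    c = 1 makes the ratios of consecutive weights, which are the weights of the
    steps, equal to s for a closing step and s / D for an opening step. *)
Definition mult_weight c : R :=
  match c with 0%N => 1 | 1%N => s / D%:R | _ => p end.
Definition step_ratio c : R :=
  match c with 0%N => s / D%:R | 1%N => s | _ => 1 end.
Definition history_weight es : R := \prod_(e : {set V}) mult_weight (count_mem e es).

Let DR0 : (0 : R) < D%:R. Proof. by rewrite ltr0n. Qed.
Let NR1 : (1 : R) <= N%:R. Proof. by rewrite ler1n ltnW. Qed.

Lemma mult_weightS c : mult_weight c.+1 = mult_weight c * step_ratio c.
Proof.
case: c => [|[|c]] /=; rewrite ?mul1r ?mulr1 //.
by rewrite mulrAC -expr2 sE mulfK // gt_eqF.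
Qed.

Lemma history_weight_cons e es :
  history_weight (e :: es) = history_weight es * step_ratio (count_mem e es).
Proof.
rewrite /history_weight (bigD1 e) //= [in RHS](bigD1 e) //= eqxx mult_weightS.
rewrite mulrAC; congr (_ * _ * _); apply: eq_bigr => f fe.
by rewrite eq_sym (negPf fe).
Qed.

Let p_gt0 : 0 < p.
Proof. by rewrite -(pmulr_lgt0 _ DR0) -sE exprn_gt0. Qed.

Lemma history_weight_ge0 es : 0 <= history_weight es.
Proof.
apply: prodr_ge0 => e _; case: count => [|[|c]] //=; last exact: ltW p_gt0.
by rewrite divr_ge0 ?ler0n // ltW.
Qed.

Let x : R := N%:R ^+ 2 / s.

(** The potential N^excess turns the step weights into a supersolution: the
    main term 2 s comes from the fresh vertices and from the closing steps, the
    term s x from repeated uses and the term s x^2 from new edges to visited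
    vertices. *)
Lemma step_sum_le u es : (size es < N)%N -> {subset es <= E} ->
  \sum_(v | [set u; v]%SET \in E)
     step_ratio (count_mem [set u; v]%SET es) *
     N%:R ^+ excess v ([set u; v]%SET :: es)
  <= s * (2 + x + x ^+ 2) * N%:R ^+ excess u es.
Proof.
move=> szN esE; set C : R := N%:R; set f := excess u es.
have C0 : 0 < C by exact: lt_le_trans NR1.
have CX a b : (a <= b)%N -> C ^+ a <= C ^+ b by move=> ab; apply: ler_weXn2l.
pose os := open_degree es u.
pose a1 : R := s / D%:R; pose a2 := s / D%:R * C ^+ 2.
pose a3 := s * (if (1 < os)%N then C^-1 else 1).
have a10 : 0 <= a1 by rewrite divr_ge0 ?ler0n ?ltW.
have a20 : 0 <= a2.
  by rewrite mulr_ge0 ?exprn_ge0 ?(ltW C0).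
have a30 : 0 <= a3.
  by rewrite mulr_ge0 ?(ltW s0) //; case: ifP => _; rewrite ?invr_ge0 ?(ltW C0).
have visE : all (fun e => #|e| == 2%N) es by apply/allP => e /esE/E2 ->.
(* Termwise bound by four indicators: every neighbour counts as possibly
   fresh, then come the visited, the open and the repeated ones. *)
rewrite (@le_trans _ _ (\sum_(v | [set u; v]%SET \in E) (
     ([set u; v]%SET \in E)%:R * a1 + (has (fun e => v \in e) es)%:R * a2
   + (count_mem [set u; v]%SET es == 1%N)%:R * a3
   + ([set u; v]%SET \in es)%:R * C) * C ^+ f)) //.
  apply: ler_sum => v uvE.
  have uv : u != v by apply/eqP => uv; have := E2 uvE; rewrite uv finset.setUid cards1.
  rewrite uvE mul1r.
  case Ec: (count_mem _ es) => [|[|c]] /=.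
  - rewrite mul0r addr0.
    have -> : [set u; v]%SET \in es = false.
      by apply/negbTE; rewrite -has_pred1 has_count Ec.
    rewrite mul0r addr0.
    have [vis|fresh] := boolP (has _ es).
      rewrite mul1r (le_trans (y := a2 * C ^+ f)) //.
        rewrite /a2 -[leRHS]mulrA -exprD ler_wpM2l // CX // addnC.
        exact: excess_new_edge.
      rewrite ler_wpM2r ?exprn_ge0 ?(ltW C0) //.
      by rewrite lerDr.
    rewrite mul0r addr0 ler_wpM2l // CX //; exact: excess_fresh.
  - rewrite mul1r (le_trans (y := a3 * C ^+ f)) //.
      have := excess_close uv Ec; rewrite -/os -/f /a3; case: ltnP => _ le.
        rewrite -[leRHS]mulrA ler_wpM2l ?(ltW s0) // mulrC ler_pdivlMr // -exprSr.
        by rewrite CX // -addn1.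
      by rewrite addn0 in le; rewrite mulr1 ler_wpM2l ?(ltW s0) // CX.
    rewrite ler_wpM2r ?exprn_ge0 ?(ltW C0) //.
    have h1 := mulr_ge0 (ler0n R (has (fun e => v \in e) es)) a20.
    have h2 := mulr_ge0 (ler0n R ([set u; v]%SET \in es)) (ltW C0).
    lra.
  - have -> : [set u; v]%SET \in es by rewrite -has_pred1 has_count Ec.
    rewrite !mul1r mul0r addr0 (le_trans (y := C * C ^+ f)) //.
      rewrite -exprS CX // -addn1; apply: excess_repeat => //; by rewrite Ec.
    rewrite ler_wpM2r ?exprn_ge0 ?(ltW C0) //.
    have h1 := mulr_ge0 (ler0n R (has (fun e => v \in e) es)) a20.
    lra.
rewrite -mulr_suml ler_wpM2r ?exprn_ge0 ?(ltW C0) //.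
rewrite !big_split /=.
have -> : s * (2 + x + x ^+ 2) = s + s * x ^+ 2 + s + s * x by ring.
have S1 := sum_indicator_le (fun v => [set u; v]%SET \in E) a10 (degD u).
have S2 := sum_indicator_le (fun v => [set u; v]%SET \in E) a20 (card_visited_le visE).
have S3 := sum_indicator_le (fun v => [set u; v]%SET \in E) a30 (card_open_le u es).
have S4 := sum_indicator_le (fun v => [set u; v]%SET \in E) (ltW C0) (card_traversed_le u es).
have B1 : D%:R * a1 = s by rewrite /a1 mulrCA divff ?mulr1 // gt_eqF.
have B2 : (2 * size es)%:R * a2 <= s * x ^+ 2.
  rewrite (le_trans (y := (C ^+ 2) * a2)) //.
    rewrite ler_wpM2r // -natrX ler_nat -mulnn leq_mul //.
    exact: ltnW.
  have -> : s * x ^+ 2 = C ^+ 4 / s by rewrite /x -/C; field; rewrite gt_eqF.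
  have -> : C ^+ 2 * a2 = C ^+ 4 * (s / D%:R) by rewrite /a2; ring.
  rewrite ler_wpM2l ?exprn_ge0 ?(ltW C0) // ler_pdivrMr // mulrC ler_pdivlMr //.
  by rewrite -expr2 sE ler_piMl // ltW.
have B3 : (open_degree es u)%:R * a3 <= s.
  rewrite /a3 mulrCA ler_piMr // ?(ltW s0) // -/os; case: ltnP => h.
    rewrite ler_pdivrMr // mul1r ler_nat (leq_trans (open_degree_le u es)) //.
    exact: ltnW.
  by rewrite mulr1 -[1]/(1%:R) ler_nat.
have B4 : (size es)%:R * C <= s * x.
  rewrite /x mulrCA divff ?gt_eqF // mulr1 expr2 ler_wpM2r ?(ltW C0) // ler_nat.
  exact: ltnW.
by rewrite -[X in _ <= X + _ + _ + _]B1 !lerD ?(le_trans S2) ?(le_trans S3) ?(le_trans S4).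
Qed.
End Weights.

(** * Expected trace of the powers of the centred adjacency matrix *)

Section PercolationMean.
Variables (R : realType) (n : nat) (E : {set {set 'I_n}}) (p : R).
Implicit Types (H : {set {set 'I_n}}) (es : seq {set 'I_n}).

Definition percolation_mean (f : {set {set 'I_n}} -> R) : R :=
  \sum_(H in powerset E) percolation_weight E p H * f H.

Definition centred_adjmx H : 'M[R]_n := adjmx R H - p *: adjmx R E.

Lemma percolation_mean_sum (I : finType) (P : pred I) (F : I -> {set {set 'I_n}} -> R) :
  percolation_mean (fun H => \sum_(i | P i) F i H) = \sum_(i | P i) percolation_mean (F i).
Proof.
rewrite /percolation_mean exchange_big /=; apply: eq_bigr => H _; exact: mulr_sumr.
Qed.

Lemma eq_percolation_mean f g : (forall H, H \subset E -> f H = g H) ->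
  percolation_mean f = percolation_mean g.
Proof.
by move=> fg; apply: eq_bigr => H; rewrite powersetE => /fg ->.
Qed.

Lemma sum_powerset_prod (a b : {set 'I_n} -> R) :
  \sum_(H in powerset E) \prod_(e in E) (if e \in H then a e else b e)
  = \prod_(e in E) (a e + b e).
Proof.
pose a' e := if e \in E then a e else 0.
pose b' e := if e \in E then b e else 1.
have -> : \prod_(e in E) (a e + b e) = \prod_e (a' e + b' e).
  rewrite big_mkcond; apply: eq_bigr => e _.
  by rewrite /a' /b'; case: (e \in E); rewrite ?add0r.
rewrite bigA_distr big_mkcond [RHS]big_mkcond /=.
apply: eq_bigr => H _; rewrite powersetE.
have [HE|/subsetPn[e eH eE]] /= := boolP (H \subset E); last first.
  by rewrite (bigD1 e) //= eH /a' (negPf eE) mul0r.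
rewrite big_mkcond; apply: eq_bigr => e _; rewrite /a' /b'.
case: ifPn => // eE; rewrite ifN //; apply: contra eE; exact: (fintype.subsetP HE).
Qed.

Lemma prod_seq_count (F : {set 'I_n} -> R) es : {subset es <= E} ->
  \prod_(e <- es) F e = \prod_(e in E) F e ^+ count_mem e es.
Proof.
elim: es => [|f es IH] esE; first by rewrite big_nil big1 // => e _; rewrite expr0.
have fE : f \in E by apply: esE; rewrite mem_head.
rewrite big_cons IH => [|e ees]; last by apply: esE; rewrite in_cons ees orbT.
rewrite (bigD1 f) //= [in RHS](bigD1 f) //= eqxx exprS mulrA; congr (_ * _).
by apply: eq_bigr => e /andP[_ fe]; rewrite eq_sym (negPf fe).
Qed.

(** Independence of the edges: the mean factorizes, and the factor of an edge e
    is the central Bernoulli moment of order the multiplicity of e in es. *)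
Lemma percolation_mean_prod es : {subset es <= E} ->
  percolation_mean (fun H => \prod_(e <- es) ((e \in H)%:R - p))
  = \prod_(e in E) (p * (1 - p) ^+ count_mem e es + (1 - p) * (- p) ^+ count_mem e es).
Proof.
move=> esE; rewrite -sum_powerset_prod; apply: eq_bigr => H _.
rewrite /percolation_weight prod_seq_count // -big_split /=.
by apply: eq_bigr => e _; case: (e \in H); rewrite ?add0r ?sub0r.
Qed.

Lemma centred_adjmxE H i j : H \subset E ->
  centred_adjmx H i j =
  if [set i; j]%SET \in E then ([set i; j]%SET \in H)%:R - p else 0.
Proof.
move=> HE; rewrite !mxE; case: ifPn => ijE; first by rewrite mulr1.
by rewrite (contraNF ((fintype.subsetP HE) _) ijE) mulr0 subr0.
Qed.

Hypothesis p01 : 0 <= p <= 1.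

(** For c >= 2 the moment is at most p (1 - p) + (1 - p) p^2 <= p. *)
Lemma bernoulli_moment_le (D : nat) (s : R) c : 0 <= s ->
  `|p * (1 - p) ^+ c + (1 - p) * (- p) ^+ c| <= mult_weight D p s c.
Proof.
move=> s0; have /andP[p0 p1] := p01; have q0 : 0 <= 1 - p by rewrite subr_ge0.
case: c => [|[|c]] /=.
- by rewrite !expr0 !mulr1 addrC subrK normr1.
- by rewrite !expr1 mulrN mulrC subrr normr0 divr_ge0.
have : (2 <= c.+2)%N by [].
move: c.+2 => m m2.
rewrite (le_trans (ler_normD _ _)) // !normrM !normrX normrN !ger0_norm //.
rewrite (le_trans (y := p * (1 - p) + (1 - p) * p ^+ 2)) //.
  rewrite lerD // ler_wpM2l //; last exact: ler_wiXn2l.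
  rewrite -[leRHS]expr1; apply: ler_wiXn2l => //; last exact: ltnW.
  by rewrite lerBlDr lerDl.
have : 0 <= p ^+ 3 by exact: exprn_ge0.
by rewrite !exprS expr0; lra.
Qed.

Variables (D N : nat) (s : R).
Hypothesis E2 : simple_graph E.
Hypothesis degD : forall u, (degree E u <= D)%N.
Hypothesis D0 : (0 < D)%N.
Hypothesis N2 : (1 < N)%N.
Hypothesis s0 : 0 < s.
Hypothesis sE : s ^+ 2 = p * D%:R.

Let growth : R := s * (2 + N%:R ^+ 2 / s + (N%:R ^+ 2 / s) ^+ 2).

(** The history es and the remaining power of the matrix are treated together,
    so that walks never have to be enumerated: expanding one factor of the power
    moves one edge to the history, and step_sum_le bounds the resulting sum.
    Once the power is exhausted, independence and the moment bounds remain. *)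
Lemma mean_walk_le t u z es : {subset es <= E} -> (size es + t <= N)%N ->
  `|percolation_mean (fun H => (\prod_(e <- es) ((e \in H)%:R - p))
                          * (centred_adjmx H ^+ t) u z)|
  <= history_weight D p s es * growth ^+ t * N%:R ^+ excess u es.
Proof.
have /andP[p0 p1] := p01.
have hw es' : 0 <= history_weight D p s es' := history_weight_ge0 D0 s0 sE es'.
elim: t u es => [|t IH] u es esE szN.
  rewrite (@eq_percolation_mean _ (fun H => (u == z)%:R * \prod_(e <- es) ((e \in H)%:R - p))); last first.
    by move=> H _; rewrite expr0 mxE mulrC.
  have -> : percolation_mean (fun H => (u == z)%:R * \prod_(e <- es) ((e \in H)%:R - p))
     = (u == z)%:R * percolation_mean (fun H => \prod_(e <- es) ((e \in H)%:R - p)).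
    by rewrite mulr_sumr; apply: eq_bigr => H _; rewrite mulrCA.
  rewrite expr0 mulr1 normrM normr_nat.
  rewrite (le_trans (y := `|percolation_mean (fun H => \prod_(e <- es) ((e \in H)%:R - p))|)) //.
    by case: (u == z); rewrite ?mul1r ?mul0r.
  rewrite (le_trans (y := history_weight D p s es)) //; last first.
    by rewrite ler_peMr // exprn_ege1 // ler1n ltnW.
  rewrite percolation_mean_prod // normr_prod /history_weight big_mkcond.
  apply: ler_prod => e _; case: ifPn => eE; first by rewrite normr_ge0 bernoulli_moment_le ?ltW.
  rewrite ler01; suff -> : count_mem e es = 0%N by rewrite /= lexx.
  by apply/count_memPn; apply: contra eE => /esE.
rewrite (@eq_percolation_mean _ (fun H => \sum_(v | [set u; v]%SET \in E)
   ((\prod_(e <- [set u; v]%SET :: es) ((e \in H)%:R - p)) * (centred_adjmx H ^+ t) v z))); last first.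
  move=> H HE; rewrite exprS mxE mulr_sumr [RHS]big_mkcond /=; apply: eq_bigr => v _.
  rewrite centred_adjmxE // big_cons; case: ifP => _; last by rewrite mul0r mulr0.
  by rewrite mulrA; congr (_ * _); rewrite mulrC.
rewrite percolation_mean_sum (le_trans (ler_norm_sum _ _ _)) //.
rewrite (le_trans (y := \sum_(v | [set u; v]%SET \in E)
  (history_weight D p s es * growth ^+ t) *
    (step_ratio D s (count_mem [set u; v]%SET es) * N%:R ^+ excess v ([set u; v]%SET :: es)))) //.
  apply: ler_sum => v uvE; rewrite (le_trans (IH _ _ _ _)) //=.
  - by move=> e; rewrite in_cons => /predU1P[->//|/esE].
  - by rewrite addSn -addnS.
  by rewrite (history_weight_cons D0 sE) [leRHS]mulrACA mulrA.
rewrite -mulr_sumr exprSr mulrA -[leRHS]mulrA ler_wpM2l //.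
  by rewrite mulr_ge0 // exprn_ge0 // mulr_ge0 ?(ltW s0) // !addr_ge0 ?exprn_ge0 ?divr_ge0 ?exprn_ge0 ?(ltW s0).
apply: (step_sum_le (E := E) (p := p)) => //.
by rewrite (leq_trans _ szN) // addnS ltnS leq_addr.
Qed.

Lemma mean_trace_le :
  percolation_mean (fun H => \tr (centred_adjmx H ^+ N)) <= n%:R * growth ^+ N.
Proof.
rewrite /mxtrace percolation_mean_sum -[n in n%:R]card_ord mulr_natl -sumr_const.
apply: ler_sum => u _; rewrite (le_trans (ler_norm _)) //.
have := @mean_walk_le N u u [::].
rewrite /history_weight big1 // mul1r.
have -> : excess u [::] = 0%N.
  by rewrite /excess big1 // => x _; rewrite open_degree_eq0.
rewrite expr0 mulr1 => /(_ _ _) h; rewrite (le_trans _ (h _ _)) //.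
rewrite le_eqVlt; apply/orP; left; apply/eqP; congr `|_|.
by apply: eq_percolation_mean => H _; rewrite big_nil mul1r.
Qed.
End PercolationMean.

(** * Weyl's inequality from a trace bound *)

Section Weyl.
Import complex.
Variables (R : realType) (n : nat).
Local Notation C := (complex R).
Local Notation toC := (real_complex R).
Local Notation "M ^t*" := (map_mx Num.conj (M^T)) (at level 30).
Implicit Types (A B M : 'M[R]_n) (v : 'rV[C]_n) (P : 'M[C]_n) (d : 'I_n -> R).

(** The spectral theorem is used over the complex numbers, so the quadratic
    form of a real matrix is evaluated at complex row vectors. *)
Definition energy v A : C := (v *m map_mx toC A *m v^t*) 0 0.
Definition sqnorm v : C := (v *m v^t*) 0 0.

Definition diagonalizes P d A :=
  P \is unitarymx /\ map_mx toC A = P^t* *m diag_mx (\row_k toC (d k)) *m P.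

Lemma exists_diagonalization A : A^T = A ->
  exists P d, diagonalizes P d A /\ perm_eq (eigenvalues A) [seq d k | k <- enum 'I_n].
Proof.
move=> symA; pose B : 'M[C]_n := map_mx toC A.
have Bh : B \is hermsymmx.
  apply: realsym_hermsym.
    apply/is_hermitianmxP; rewrite expr0 scale1r map_mx_id //.
    by apply/matrixP => i j; rewrite !mxE -{1}symA mxE.
  by apply/mxOverP => i j; rewrite mxE complex_real.
have /orthomx_spectralP BE := hermitian_normalmx Bh.
have dr := hermitian_spectral_diag_real Bh.
pose P := spectralmx B; have uP : P \is unitarymx := spectral_unitarymx B.
pose d k := complex.Re (spectral_diag B 0 k).
have dE : spectral_diag B = \row_k toC (d k).
  by apply/rowP => k; rewrite mxE RRe_real // (mxOverP dr).
exists P, d; split; first by split=> //; rewrite -invmx_unitary // -dE.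
apply/allP => x _ /=; rewrite count_eigenvalues -mu_prod_XsubC; apply/eqP.
congr mup; apply: (map_poly_inj toC).
rewrite map_char_poly -/B {1}BE char_poly_conj ?spectral_unit //.
rewrite char_poly_trig ?diag_mx_is_trig // rmorph_prod /= big_map big_enum /=.
apply: eq_bigr => i _; rewrite rmorphB /= map_polyX map_polyC /= mxE eqxx mulr1n.
by rewrite dE mxE.
Qed.

Lemma mulmx_adjoint P v : P *m v^t* = (v *m P^t*)^t*.
Proof. by rewrite trmx_mul map_mxM trmxCK. Qed.

Lemma sqnormE P v : P \is unitarymx ->
  sqnorm v = \sum_k `|(v *m P^t*) 0 k| ^+ 2.
Proof.
move=> uP; have PP : P^t* *m P = 1%:M by rewrite -invmx_unitary // mulVmx ?unitarymx_unit.
rewrite /sqnorm (_ : v *m v^t* = (v *m P^t*) *m (v *m P^t*)^t*); last first.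
  by rewrite -mulmx_adjoint mulmxA -(mulmxA v) PP mulmx1.
by rewrite mxE; apply: eq_bigr => k _; rewrite normCK; congr (_ * _); rewrite [LHS]mxE mxE.
Qed.

Lemma energyE P d A v : diagonalizes P d A ->
  energy v A = \sum_k toC (d k) * `|(v *m P^t*) 0 k| ^+ 2.
Proof.
case=> uP AE; rewrite /energy AE !mulmxA -mulmxA mulmx_adjoint mxE.
apply: eq_bigr => k _; rewrite mul_mx_diag normCK mulrA [toC _ * _]mulrC.
by congr (_ * _); [rewrite mxE [X in _ * X]mxE|rewrite [LHS]mxE mxE].
Qed.

Lemma sqnorm_gt0 v : v != 0 -> 0 < sqnorm v.
Proof.
move=> v0; have := dotmx_is_dotmx v0; by rewrite dotmxE.
Qed.

Lemma energy_le P d A v b : diagonalizes P d A ->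
  (forall k, (v *m P^t*) 0 k != 0 -> d k <= b) -> energy v A <= toC b * sqnorm v.
Proof.
move=> dA h; rewrite (energyE _ dA) (sqnormE _ dA.1) mulr_sumr.
apply: ler_sum => k _; have [->|/h le] := eqVneq ((v *m P^t*) 0 k) 0.
  by rewrite normr0 expr0n !mulr0.
by rewrite ler_wpM2r ?exprn_ge0 // lecR.
Qed.

Lemma energy_ge P d A v b : diagonalizes P d A ->
  (forall k, (v *m P^t*) 0 k != 0 -> b <= d k) -> toC b * sqnorm v <= energy v A.
Proof.
move=> dA h; rewrite (energyE _ dA) (sqnormE _ dA.1) mulr_sumr.
apply: ler_sum => k _; have [->|/h le] := eqVneq ((v *m P^t*) 0 k) 0.
  by rewrite normr0 expr0n !mulr0.
by rewrite ler_wpM2r ?exprn_ge0 // lecR.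
Qed.

(** The coordinates outside S in the orthonormal basis P impose n - #|S|
    linear conditions, whose solutions form a space of dimension at least #|S|. *)
Lemma supported_kernel P (S : {set 'I_n}) : exists2 K : 'M[C]_n, (#|S| <= \rank K)%N &
  forall v, (v <= K)%MS -> forall k, (v *m P^t*) 0 k != 0 -> k \in S.
Proof.
pose W : 'M[C]_(n, #|~: S|) := colsub (fun j => enum_val j) (P^t*).
exists (kermx W).
  have := cardsC S; rewrite card_ord mxrank_ker; have := rank_leq_col W; lia.
move=> v /sub_kermxP vW k; apply: contraR => kS.
have kS' : k \in ~: S by rewrite inE.
have /rowP /(_ (enum_rank_in kS' k)) := vW.
rewrite !mxE => E; rewrite -[X in _ == X]E; apply/eqP; apply: eq_bigr => j _.
by rewrite !mxE enum_rankK_in.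
Qed.

Lemma card_eigval_ge A d (i : 'I_n) : A^T = A -> perm_eq (eigenvalues A) [seq d k | k <- enum 'I_n] ->
  (n - i <= #|[set k | (eigval A i <= d k)%R]%SET|)%N.
Proof.
move=> symA dA; set a := eigval A i.
have -> : #|[set k | a <= d k]%SET| = count (fun x => a <= x) (eigenvalues A).
  rewrite (permP dA) count_map cardE -size_filter enumT; congr size.
  by apply: eq_filter => k; rewrite !inE.
have sz := size_eigenvalues symA.
rewrite -(cat_take_drop i (eigenvalues A)) count_cat.
rewrite (leq_trans _ (leq_addl _ _)) //.
have -> : count (fun x => a <= x) (drop i (eigenvalues A)) = size (drop i (eigenvalues A)).
  apply/eqP; rewrite -all_count; apply/(all_nthP 0) => j; rewrite size_drop nth_drop sz => ji.
  apply: (sorted_leq_nth le_trans lexx 0 (sorted_eigenvalues A)); rewrite ?inE ?sz ?leq_addr //.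
  lia.
by rewrite size_drop sz.
Qed.

Lemma card_eigval_le A d (i : 'I_n) : A^T = A -> perm_eq (eigenvalues A) [seq d k | k <- enum 'I_n] ->
  (i < #|[set k | (d k <= eigval A i)%R]%SET|)%N.
Proof.
move=> symA dA; set a := eigval A i.
have -> : #|[set k | d k <= a]%SET| = count (fun x => x <= a) (eigenvalues A).
  rewrite (permP dA) count_map cardE -size_filter enumT; congr size.
  by apply: eq_filter => k; rewrite !inE.
have sz := size_eigenvalues symA.
rewrite -(cat_take_drop i.+1 (eigenvalues A)) count_cat.
rewrite (leq_trans _ (leq_addr _ _)) //.
have szt : size (take i.+1 (eigenvalues A)) = i.+1 by rewrite size_takel ?sz.
have -> : count (fun x => x <= a) (take i.+1 (eigenvalues A)) = i.+1 => //.
  rewrite -[RHS]szt.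
  apply/eqP; rewrite -all_count; apply/(all_nthP 0) => j; rewrite szt => ji.
  rewrite nth_take //.
  apply: (sorted_leq_nth le_trans lexx 0 (sorted_eigenvalues A)); rewrite ?inE ?sz //.
  exact: leq_trans ji (ltn_ord i).
Qed.

(** The span of the eigenvectors of A from rank i upwards and that of the
    eigenvectors of B up to rank i have dimensions at least n - i and i + 1, so
    they intersect nontrivially.  This replaces the min-max principle. *)
Lemma exists_common_vector A B i : A^T = A -> B^T = B ->
  exists2 v, v != 0 & toC (eigval A i) * sqnorm v <= energy v A /\
                      energy v B <= toC (eigval B i) * sqnorm v.
Proof.
move=> symA symB.
have [P [d [dA pA]]] := exists_diagonalization symA.
have [Q [f [fB pB]]] := exists_diagonalization symB.
have [K rK Ksub] := supported_kernel P [set k | eigval A i <= d k]%SET.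
have [L rL Lsub] := supported_kernel Q [set k | f k <= eigval B i]%SET.
have := mxrank_sum_cap K L; have := rank_leq_col (K + L)%MS.
have := card_eigval_ge i symA pA; have := card_eigval_le i symB pB => c1 c2 c3 c4.
have KL0 : (K :&: L)%MS != 0.
  have r1 := leq_trans c2 rK; have r2 := leq_trans c1 rL; have := ltn_ord i.
  move: r1 r2 c3 c4; rewrite -mxrank_eq0; clear; lia.
exists (nz_row (K :&: L)%MS); first by rewrite nz_row_eq0.
have := nz_row_sub (K :&: L)%MS; rewrite sub_capmx => /andP[vK vL].
split.
  by apply: (energy_ge dA) => k /(Ksub _ vK); rewrite inE.
by apply: (energy_le fB) => k /(Lsub _ vL); rewrite inE.
Qed.

Lemma trace_expr_diag P d M N : diagonalizes P d M ->
  \tr (M ^+ N) = \sum_k d k ^+ N.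
Proof.
case=> uP ME; apply: (@complexI R).
transitivity (\tr (map_mx toC (M ^+ N))); first by rewrite -trace_map_mx.
have -> : map_mx toC (M ^+ N) = P^t* *m diag_mx (\row_k toC (d k ^+ N)) *m P.
  elim: N => [|N IH].
    rewrite expr0 map_mx1 (_ : diag_mx _ = 1%:M) ?mulmx1.
      by rewrite -invmx_unitary // mulVmx ?unitarymx_unit.
    by apply/matrixP => i j; rewrite !mxE expr0.
  rewrite exprS map_mxM IH ME !mulmxA; congr (_ *m _).
  rewrite -[X in X *m _ = _]mulmxA (unitarymxP uP) mulmx1 -mulmxA; congr (_ *m _).
  by rewrite mulmx_diag; congr diag_mx; apply/rowP => k; rewrite !mxE exprS rmorphM.
rewrite mxtrace_mulC mulmxA (unitarymxP uP) mul1mx mxtrace_diag rmorph_sum.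
by apply: eq_bigr => k _; rewrite mxE.
Qed.

(** For even N, every summand of the trace of M^N, the sum of the N-th powers
    of the eigenvalues, is nonnegative and hence at most b^N. *)
Lemma abs_energy_le M b N v : M^T = M -> 0 <= b -> (0 < N)%N -> ~~ odd N ->
  \tr (M ^+ N) <= b ^+ N ->
  energy v M <= toC b * sqnorm v /\ - (toC b * sqnorm v) <= energy v M.
Proof.
move=> symM b0 N0 evN; have [P [d [dM _]]] := exists_diagonalization symM.
rewrite (trace_expr_diag _ dM) => le.
have db k : `|d k| <= b.
  rewrite -(ler_pXn2r N0) ?nnegrE // (le_trans _ le) // (bigD1 k) //=.
  rewrite -normrX ger0_norm; last by rewrite exprn_even_ge0.
  by rewrite lerDl sumr_ge0 // => j _; rewrite exprn_even_ge0.
split; first by apply: (energy_le dM) => k _; apply: le_trans (ler_norm _) (db k).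
rewrite -mulNr -rmorphN; apply: (energy_ge dM) => k _.
by have := db k; rewrite ler_norml => /andP[].
Qed.

Lemma energyB v A p B : energy v (A - p *: B) = energy v A - toC p * energy v B.
Proof.
by rewrite /energy map_mxB map_mxZ mulmxBr mulmxBl -scalemxAr -scalemxAl !mxE.
Qed.

(** The factor p >= 0 is kept outside eigval, which spares the computation of
    the eigenvalues of a multiple of B. *)
Lemma weyl_trace A B p b N i : A^T = A -> B^T = B -> 0 <= p -> 0 <= b ->
  (0 < N)%N -> ~~ odd N -> \tr ((A - p *: B) ^+ N) <= b ^+ N ->
  `|eigval A i - p * eigval B i| <= b.
Proof.
move=> symA symB p0 b0 N0 evN le.
have symM : (A - p *: B)^T = A - p *: B by rewrite linearB linearZ /= symA symB.
have key v : v != 0 -> forall x y, toC x * sqnorm v <= toC y * sqnorm v -> x <= y.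
  by move=> v0 x y; rewrite ler_pM2r ?lecR //; exact: sqnorm_gt0.
have p0C : 0 <= toC p by rewrite -[0]/(toC 0) lecR.
rewrite ler_norml; apply/andP; split.
  have [v v0 [hB hA]] := exists_common_vector i symB symA.
  have [_] := abs_energy_le v symM b0 N0 evN le; rewrite energyB => hM.
  apply: (key v v0); rewrite rmorphN rmorphB rmorphM mulNr mulrBl -mulrA.
  by apply: le_trans hM _; rewrite lerB // ler_wpM2l.
have [v v0 [hA hB]] := exists_common_vector i symA symB.
have [+ _] := abs_energy_le v symM b0 N0 evN le; rewrite energyB => hM.
apply: (key v v0); rewrite rmorphB rmorphM mulrBl -mulrA.
by apply: le_trans hM; rewrite lerB // ler_wpM2l.
Qed.
End Weyl.

(** * Tail bound and asymptotics *)

Section Tail.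
Variables (R : realType) (n : nat) (E : {set {set 'I_n}}) (p : R).
Hypothesis p01 : 0 <= p <= 1.
Implicit Types H : {set {set 'I_n}}.

Lemma percolation_weight_ge0 H : 0 <= percolation_weight E p H.
Proof.
have /andP[p0 p1] := p01; apply: prodr_ge0 => e _.
by case: ifP; rewrite ?subr_ge0.
Qed.

Lemma sum_percolation_weight : \sum_(H in powerset E) percolation_weight E p H = 1.
Proof.
have := percolation_prob_subset p (finset.sub0set E).
rewrite cards0 expr0 /percolation_prob => <-; apply: eq_bigl => H.
by rewrite finset.sub0set andbT.
Qed.

Lemma percolation_prob_le1 Q : percolation_prob E p Q <= 1.
Proof.
rewrite -sum_percolation_weight /percolation_prob [leLHS]big_mkcondr /=.
by apply: ler_sum => H _; case: ifP => // _; exact: percolation_weight_ge0.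
Qed.

Lemma markov_percolation (Q : pred {set {set 'I_n}}) (f : {set {set 'I_n}} -> R) (c : R) :
  0 < c -> (forall H, H \subset E -> 0 <= f H) ->
  (forall H, H \subset E -> ~~ Q H -> c <= f H) ->
  1 - percolation_mean E p f / c <= percolation_prob E p Q.
Proof.
move=> c0 f0 fc; rewrite lerBlDr -[leLHS]sum_percolation_weight.
rewrite /percolation_prob [X in _ <= X + _]big_mkcondr /= /percolation_mean mulr_suml -big_split /=.
apply: ler_sum => H; rewrite powersetE => HE; have w0 := percolation_weight_ge0 H.
case: ifPn => QH; first by rewrite lerDl divr_ge0 ?(ltW c0) // mulr_ge0 // f0.
by rewrite add0r ler_pdivlMr // ler_wpM2l // fc.
Qed.

Variables (D k : nat).
Hypothesis E2 : simple_graph E.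
Hypothesis degD : forall u, (degree E u <= D)%N.
Hypothesis k0 : (0 < k)%N.

Lemma percolation_spectral_tail (b s x : R) : 0 < b -> 0 < s ->
  s ^+ 2 = p * D%:R -> x = k.*2%:R ^+ 2 / s ->
  1 - n%:R * (s * (2 + x + x ^+ 2) / b) ^+ k.*2 <=
  percolation_prob E p (fun H => [forall i : 'I_n,
    `|eigval (adjmx R H) i - p * eigval (adjmx R E) i| <= b]).
Proof.
move=> b0 s0 sE ->; have /andP[p0 p1] := p01.
have D0 : (0 < D)%N.
  by case: (D) sE => [|//] /eqP; rewrite mulr0 expf_eq0 gt_eqF.
have N2 : (1 < k.*2)%N by lia.
have symM H : (centred_adjmx E p H)^T = centred_adjmx E p H.
  by rewrite linearB linearZ /= !adjmx_sym.
have N0 : (0 < k.*2)%N by lia.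
have evN : ~~ odd k.*2 by rewrite odd_double.
apply: (le_trans _ (@markov_percolation _
    (fun H => \tr (centred_adjmx E p H ^+ k.*2)) (b ^+ k.*2) _ _ _)).
- rewrite lerD2l lerN2 expr_div_n mulrA ler_pM2r ?invr_gt0 ?exprn_gt0 //.
  exact: mean_trace_le.
- by rewrite exprn_gt0.
- move=> H _; have [P [d [dM _]]] := exists_diagonalization (symM H).
  by rewrite (trace_expr_diag _ dM) sumr_ge0 // => j _; rewrite exprn_even_ge0.
move=> H _; apply: contraR; rewrite -ltNge => /ltW le; apply/forallP => i.
by apply: (weyl_trace i _ _ p0 (ltW b0) N0 evN le); rewrite adjmx_sym.
Qed.
End Tail.

Local Open Scope classical_set_scope.

(** Here the walk length is chosen: N = 2 k with k the least integer above
    L r, where L = ln n and d = L^4 r^8.  Then k <= 2 L r gives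
    N^2 / sqrt d <= 16 / r^2, which is small, and N / r >= 2 L makes the factor
    expR (1 / r) of slack, raised to the power N, at least n^2; this beats the
    dimension n in the trace bound. *)
Lemma eigval_deviation_le (R : realType) (n : nat) (E : {set {set 'I_n}}) (p r : R) :
  simple_graph E -> 0 <= p <= 1 -> 1 <= ln (n%:R : R) -> 1 <= r ->
  let d := p * (max_degree E)%:R in
  let y := r^-1 in
  d = ln (n%:R : R) ^+ 4 * r ^+ 8 ->
  1 - n%:R^-1 <=
  percolation_prob E p (fun H => [forall i : 'I_n,
    `|eigval (adjmx R H) i - p * eigval (adjmx R E) i| <=
       (2 + 16 * y ^+ 2 + (16 * y ^+ 2) ^+ 2) * expR y * Num.sqrt d]).
Proof.
move=> E2 p01 L1 r1 d y dE; set L := ln n%:R in L1 dE.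
have L0 : 0 < L by exact: lt_le_trans L1.
have r0 : 0 < r by exact: lt_le_trans r1.
have n0 : 0 < n%:R :> R.
  by rewrite lt_neqAle ler0n andbT; apply/eqP => n0; move: L0; rewrite /L -n0 ln0 ?ltxx.
have y0 : 0 < y by rewrite invr_gt0.
have d0 : 0 < d by rewrite dE mulr_gt0 ?exprn_gt0.
set s := Num.sqrt d.
have s0 : 0 < s by rewrite sqrtr_gt0.
have sE : s = L ^+ 2 * r ^+ 4.
  rewrite /s dE -[4%N]/(2 * 2)%N -[8%N]/(4 * 2)%N !exprM -exprMn sqrtr_sqr ger0_norm //.
  by rewrite mulr_ge0 ?exprn_ge0 ?(ltW L0) ?(ltW r0).
have s2E : s ^+ 2 = d by rewrite sqr_sqrtr // ltW.
have degD u : (degree E u <= max_degree E)%N by exact: leq_bigmax.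
pose k := (Num.trunc (L * r)).+1.
have kgt : L * r < k%:R by exact: truncnS_gt.
have Lr1 : 1 <= L * r by rewrite mulr_ege1.
have kle : k%:R <= 2 * (L * r).
  have /andP[le _] := truncn_itv (ltW (lt_le_trans ltr01 Lr1)).
  by rewrite /k -addn1 natrD mulr_natl mulr2n lerD.
set z := 16 * y ^+ 2; set g := 2 + z + z ^+ 2.
have z0 : 0 <= z by rewrite mulr_ge0 ?exprn_ge0 ?(ltW y0).
have g0 : 0 < g by rewrite /g -addrA ltr_pwDl // addr_ge0 ?exprn_ge0.
have b0 : 0 < g * expR y * s by rewrite !mulr_gt0 // expR_gt0.
set x := k.*2%:R ^+ 2 / s.
apply: (le_trans _ (percolation_spectral_tail (k := k) p01 E2 degD isT b0 s0 s2E (erefl x))).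
rewrite lerD2l lerN2.
have x0 : 0 <= x by rewrite divr_ge0 ?exprn_ge0 ?(ltW s0).
have xz : x <= z.
  rewrite /x ler_pdivrMr // sE /z /y.
  have -> : 16 * r^-1 ^+ 2 * (L ^+ 2 * r ^+ 4) = (2 * (2 * (L * r))) ^+ 2.
    by field; rewrite gt_eqF.
  rewrite ler_pXn2r ?nnegrE ?mulr_ge0 ?(ltW L0) ?(ltW r0) //.
  by rewrite -muln2 natrM mulrC ler_wpM2l.
have -> : s * (2 + x + x ^+ 2) / (g * expR y * s) = (2 + x + x ^+ 2) / g * expR (- y).
  by rewrite expRN; field; rewrite !gt_eqF ?expR_gt0.
have h1 : 0 <= (2 + x + x ^+ 2) / g * expR (- y) <= expR (- y).
  apply/andP; split.
    by rewrite !mulr_ge0 ?invr_ge0 ?(ltW g0) ?expR_ge0 // !addr_ge0 ?exprn_ge0.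
  rewrite ler_piMl ?expR_ge0 // ler_pdivrMr // mul1r /g !lerD //.
  by rewrite ler_pXn2r.
have /andP[h2 h3] := h1.
rewrite (le_trans (y := n%:R * expR (- y) ^+ k.*2)) //.
  by rewrite ler_wpM2l ?ler0n // ler_pXn2r ?nnegrE ?expR_ge0 //.
rewrite -expRM_natl.
rewrite (le_trans (y := n%:R * expR (- (2 * L)))) //.
  rewrite ler_wpM2l ?ler0n // ler_expR mulrN lerN2 /y ler_pdivlMr //.
  by rewrite -muln2 natrM [leRHS]mulrC -mulrA ler_wpM2l // ltW.
have eL : expR L = n%:R by rewrite lnK.
have -> : 2 * L = L + L by rewrite mulr_natl mulr2n.
by rewrite expRN expRD eL invfM mulrA divff ?mul1r ?gt_eqF.
Qed.

Lemma cvg_correction (R : realType) (y : nat -> R) : y @ \oo --> (0 : R) ->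
  (fun n => (2 + 16 * y n ^+ 2 + (16 * y n ^+ 2) ^+ 2) * expR (y n) - 2) @ \oo --> (0 : R).
Proof.
move=> y0.
have sq (u : nat -> R) (l : R) : u @ \oo --> l -> (fun n => u n ^+ 2) @ \oo --> l ^+ 2.
  by move=> ul; under eq_fun do rewrite expr2; rewrite expr2; exact: cvgM.
have c16 : (fun n => 16 * y n ^+ 2) @ \oo --> (16 * 0 ^+ 2 : R).
  by apply: cvgM; [exact: cvg_cst|exact: sq].
have cexp : (fun n => expR (y n)) @ \oo --> (expR 0 : R).
  exact: cvg_comp y0 (@continuous_expR R 0).
have -> : (0 : R) = (2 + 16 * 0 ^+ 2 + (16 * 0 ^+ 2) ^+ 2) * expR 0 - 2.
  by rewrite expR0; ring.
apply: cvgB; last exact: cvg_cst.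
apply: cvgM => //; apply: cvgD; last exact: sq.
by apply: cvgD => //; exact: cvg_cst.
Qed.

Theorem theorem3 (R : realType) (G : forall n : nat, {set {set 'I_n}})
    (p : nat -> R)
    (hG : forall n : nat, simple_graph (G n))
    (hp : forall n : nat, 0 <= p n <= 1)
    (hDelta : much_greater (fun n => (max_degree (G n))%:R : R)
                           (fun n => ln (n%:R : R) ^+ 4))
    (hpDelta : much_greater p
       (fun n => ln (n%:R : R) ^+ 4 / (max_degree (G n))%:R)) :
  exists2 eps : nat -> R, eps @ \oo --> (0 : R) &
    (fun n => percolation_prob (G n) (p n) (fun H : {set {set 'I_n}} =>
       [forall i : 'I_n,
          `|eigval (adjmx R H) i - p n * eigval (adjmx R (G n)) i|
          <= (2 + eps n) * Num.sqrt (p n * (max_degree (G n))%:R)]))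
      @ \oo --> (1 : R).
Proof.
pose L n : R := ln n%:R; pose d n : R := p n * (max_degree (G n))%:R.
pose q n := p n / (L n ^+ 4 / (max_degree (G n))%:R).
have qE n : q n = d n / L n ^+ 4 by rewrite /q /d invf_div mulrA.
(* Any root of q beyond the fourth would do: walks of length about L r are long
   compared with ln n = L, and (L r)^4 is negligible against d = L^4 r^8. *)
pose r n := Num.sqrt (Num.sqrt (Num.sqrt (q n))).
have rge (A : R) : 0 <= A -> forall n, A ^+ 8 <= q n -> A <= r n.
  move=> A0 n; rewrite -[8%N]/(2 * 2 * 2)%N !exprM => le.
  have le_sqrt (a b : R) : 0 <= a -> a ^+ 2 <= b -> a <= Num.sqrt b.
    by move=> a0 ab; rewrite -(ger0_norm a0) -sqrtr_sqr ler_wsqrtr.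
  rewrite /r; apply: (le_sqrt) => //; apply: (le_sqrt); first exact: exprn_ge0.
  by apply: (le_sqrt); first exact: sqr_ge0.
have roo : r @ \oo --> +oo.
  apply/cvgryPge => A; near=> n; apply: le_trans (ler_norm A) _.
  by apply: rge => //; near: n; exact: (cvgryPge (F := \oo) q).1 hpDelta _.
pose y n := (r n)^-1.
have y0 : y @ \oo --> (0 : R).
  apply/gtr0_cvgV0 => //; near=> n; apply: lt_le_trans ltr01 _.
  by near: n; exact: (cvgryPge (F := \oo) r).1 roo 1.
pose eps n := (2 + 16 * y n ^+ 2 + (16 * y n ^+ 2) ^+ 2) * expR (y n) - 2.
exists eps; first exact: cvg_correction.
apply: (@squeeze_cvgr _ _ _ R (fun n => 1 - n%:R^-1) (fun=> 1)).
- near=> n.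
  rewrite percolation_prob_le1 // andbT.
  have r1 : 1 <= r n by near: n; exact: (cvgryPge (F := \oo) r).1 roo 1.
  have q1 : 1 <= q n by near: n; exact: (cvgryPge (F := \oo) q).1 hpDelta 1.
  have L1 : 1 <= L n.
    have en : expR 1 <= n%:R :> R by near: n; exact: nbhs_infty_ger.
    rewrite -[leLHS](expRK 1) ler_ln ?posrE ?expR_gt0 //.
    exact: lt_le_trans (expR_gt0 1) en.
  have L40 : 0 < L n ^+ 4 by rewrite exprn_gt0 // (lt_le_trans ltr01).
  have := @eigval_deviation_le R n (G n) (p n) (r n) (hG n) (hp n) L1 r1 _.
  have -> : 2 + eps n = (2 + 16 * y n ^+ 2 + (16 * y n ^+ 2) ^+ 2) * expR (y n).
    by rewrite addrC subrK.
  apply.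
  have q0 : 0 <= q n by exact: le_trans q1.
  rewrite /r -[8%N]/(2 * (2 * 2))%N !exprM !sqr_sqrtr ?sqrtr_ge0 //.
  by rewrite qE [RHS]mulrC divfK // gt_eqF.
- rewrite -[X in _ --> X]subr0; apply: cvgB; first exact: cvg_cst.
  apply/gtr0_cvgV0; last exact: cvgr_idn.
  by exists 1%N => // n; rewrite /= ltr0n.
- exact: cvg_cst.
Unshelve. all: by end_near. Qed.
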